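(* Let $\langle T,\bar\mu\rangle$ be a probability tree such that for every $t\in T\smallsetminus\max T$ there is $0<\alpha_t\le\omega$ with $\mathrm{succ}_T(t)=\{t^\frown\langle k\rangle:k<\alpha_t\}$. Let $A\subseteq[T]$ and $B\subseteq[0,1]$. With $f_{\bar\mu},g_{\bar\mu},V^*_{\bar\mu},N^*_{\bar\mu},G^*_A,G^*_{\bar\mu},I^*_x,\lambda^{\bar\mu}$ as defined in the context: (a) If $A\in\mathcal B([T])$ then $f_{\bar\mu}[A]\in\mathcal B([0,1])$. Furthermore, $\mathrm{Lb}(f_{\bar\mu}[A])=\lambda^{\bar\mu}(A\cap V^*_{\bar\mu})$ and $$\lambda^{\bar\mu}(A)=\mathrm{Lb}(f_{\bar\mu}[A])+\mathrm{Lb}(G^*_A)=\mathrm{Lb}(f_{\bar\mu}[A])+\sum_{x\in A\smallsetminus V^*_{\bar\mu}}\mathrm{Lb}(I^*_x).$$ (b) If $B\in\mathcal B([0,1])$ then $f_{\bar\mu}^{-1}[B]\in\mathcal B([T])$ and $\lambda^{\bar\mu}(f_{\bar\mu}^{-1}[B])=\mathrm{Lb}(B\smallsetminus G^*_{\bar\mu})$. As a consequence, $\mathrm{Lb}(B)=\lambda^{\bar\mu}(f_{\bar\mu}^{-1}[B])+\mathrm{Lb}(B\cap G^*_{\bar\mu})$. (c) $A\in\mathcal B([T])$ iff $A\cap N^*_{\bar\mu}\in\mathcal B([T])$ and $f_{\bar\mu}[A]\in\mathcal B([0,1])$. (d) $B\in\mathcal B([0,1])$ iff $B\cap G^*_{\bar\mu}\in\mathcal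 B([0,1])$ and $f_{\bar\mu}^{-1}[B]\in\mathcal B([T])$. (e) $B\in\mathcal B([0,1])$ iff $B\cap G^*_{\bar\mu}\in\mathcal B([0,1])$ and $g_{\bar\mu}[B]\in\mathcal B([T])$. In this case, $\mathrm{Lb}(B\smallsetminus G^*_{\bar\mu})=\lambda^{\bar\mu}(g_{\bar\mu}[B]\cap V^*_{\bar\mu})$. (f) $A\in\mathcal B([T])$ iff $A\cap N^*_{\bar\mu}\in\mathcal B([T])$ and $g_{\bar\mu}^{-1}[A]\in\mathcal B([0,1])$. In this case, $\mathrm{Lb}(g_{\bar\mu}^{-1}[A])=\lambda^{\bar\mu}(A)$.
   Context: $\mathrm{Lb}$ is Lebesgue measure; $\mathcal B(X)$ is the Borel $\sigma$-algebra. A tree (of sequences) is a non-empty set $T$ of finite sequences with entries in some set, closed under initial segments and ordered by $s\subseteq t$ ($t$ extends $s$). $\mathrm{succ}_T(t)$ is the set of $t'\in T$ extending $t$ with $|t'|=|t|+1$; $\max T=\{t\in T:\mathrm{succ}_T(t)=\emptyset\}$; $\lim T$ is the set of infinite sequences $x$ (indexed by $\omega$) with $x\upharpoonright n\in T$ for all $n<\omega$; $[T]=\lim T\cup\max T$, with the topology generated by $[t]_T=\{x\in[T]:t\subseteq x\}$, $t\in T$. For finite $x$ put $x\upharpoonright n=x$ when $n\ge|x|$. A probability tree is a pair $\langle T,\bar\mu\rangle$ where $T$ is a countable tree of sequences and $\bar\mu=\langle\mu_t:t\in T\smallsetminus\max T\rangle$ with each $\mu_t$ a probability measure on $\mathcal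 P(\mathrm{succ}_T(t))$. Closed intervals $I_t=[a_t,b_t]\subseteq[0,1]$, $t\in T$, are defined by recursion on $|t|$: $I_{\langle\,\rangle}=[0,1]$; if $t\notin\max T$ then $a_{t^\frown\langle0\rangle}=a_t$, $b_{t^\frown\langle k\rangle}=a_{t^\frown\langle k\rangle}+\mathrm{Lb}(I_t)\,\mu_t(\{t^\frown\langle k\rangle\})$ for $k<\alpha_t$, and $a_{t^\frown\langle k+1\rangle}=b_{t^\frown\langle k\rangle}$ when $k+1<\alpha_t$. $Q_{\bar\mu}=\{a_t,b_t:t\in T\}$ (countable). For $x\in[T]$, $f^-_{\bar\mu}(x)=\lim_n a_{x\upharpoonright n}$, $f^+_{\bar\mu}(x)=\lim_n b_{x\upharpoonright n}$, $I^*_x=\bigcap_{n<\omega}I_{x\upharpoonright n}=[f^-_{\bar\mu}(x),f^+_{\bar\mu}(x)]$; for $A\subseteq[T]$, $I^*(A)=\bigcup_{x\in A}I^*_x$. $\lambda^{\bar\mu}(A)=\mathrm{Lb}(I^*(A))$ for $A\in\mathcal B([T])$; it is the unique probability measure on $\mathcal B([T])$ with $\lambda^{\bar\mu}([t]_T)=\prod_{k<|t|}\mu_{t\upharpoonright k}(\{t\upharpoonright(k+1)\})$ for all $t\in T$. $g_{\bar\mu}\colon[0,1]\smallsetminus Q_{\bar\mu}\to[T]$ sends $y$ to the unique $x\in[T]$ with $y\in I^*_x$. $V^*_{\bar\mu}=\{x\in[T]:\lambda^{\bar\mu}(\{x\})=0\}$; for $x\in V^*_{\bar\mu}$ the set $I^*_x$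 is a singleton, and $f_{\bar\mu}\colon V^*_{\bar\mu}\to[0,1]$ sends $x$ to the unique point of $I^*_x$. $G^*_A=\bigcup_{x\in A\smallsetminus V^*_{\bar\mu}}(f^-_{\bar\mu}(x),f^+_{\bar\mu}(x))$ (open intervals) and $G^*_{\bar\mu}=G^*_{[T]}$. $N^*_{\bar\mu}=\bigcup\{[t]_T:t\in T,\ \lambda^{\bar\mu}([t]_T)=0\}$. For a partial function $h$, $h[A]$ means $\{h(x):x\in A\cap\mathrm{dom}\,h\}$ and $h^{-1}[B]=\{x\in\mathrm{dom}\,h:h(x)\in B\}$. *)

(* Defs.v *)
From HB Require Import structures.
From mathcomp Require Import all_boot all_order all_algebra.
From mathcomp Require Import all_classical all_reals all_analysis.

Set Implicit Arguments.
Unset Strict Implicit.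
Unset Printing Implicit Defensive.

Import Order.TTheory GRing.Theory Num.Theory.
Import numFieldNormedType.Exports.

Local Open Scope classical_set_scope.
Local Open Scope ring_scope.

HB.instance Definition _ := isPointed.Build (seq nat) [::].

(* Since succ_T(t) = {t^<k> : k < alpha_t} for every non-maximal t, all entries
   of all members of the trees considered are natural numbers, so a tree is a
   set of type [set (seq nat)]. *)

Definition is_tree (T : set (seq nat)) : Prop :=
  T !=set0 /\ (forall s t, T t -> prefix s t -> T s).

Definition succT (T : set (seq nat)) (t : seq nat) : set (seq nat) :=
  [set t' | [/\ T t', prefix t t' & size t' = (size t).+1]].

Definition maxT (T : set (seq nat)) : set (seq nat) :=
  [set t | T t /\ succT T t = set0].

Definition limT (T : set (seq nat)) : set (nat -> nat) :=
  [set u | forall n, T (mkseq u n)].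

(* Ordinals alpha <= omega: [Some n] is n and [None] is omega. *)
Definition below (k : nat) (alpha : option nat) : Prop :=
  if alpha is Some n then (k < n)%N else True.

(* Sequences of length <= omega: [inl s] is finite, [inr u] is infinite. *)
Definition xseq : Type := (seq nat + (nat -> nat))%type.

Definition restr (x : xseq) (n : nat) : seq nat :=
  match x with inl s => take n s | inr u => mkseq u n end.

Definition extends (x : xseq) (t : seq nat) : Prop := restr x (size t) = t.

Lemma extends_inl (s t : seq nat) : extends (inl s) t <-> prefix t s.
Proof. by rewrite /extends prefixE; split => /eqP. Qed.

(* The space [T], with the topology generated by the sets [t]_T, t in T. *)
Record bdry (T : set (seq nat)) := Bdry {
  bval :> xseq ;
  bvalP : (inl @` maxT T `|` inr @` limT T) bval }.

Definition cone (T : set (seq nat)) (t : seq nat) : set (bdry T) :=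
  [set x | extends x t].
Arguments cone : clear implicits.

HB.instance Definition _ T := gen_eqMixin (bdry T).
HB.instance Definition _ T := gen_choiceMixin (bdry T).
HB.instance Definition _ T :=
  @isSubBaseTopological.Build (bdry T) (seq nat) T (cone T).

Definition borel (X : topologicalType) : set (set X) := <<s @open X >>.

HB.instance Definition _ := @isMeasurable.Build default_measure_display
  (seq nat) discrete_measurable discrete_measurable0
  discrete_measurableC discrete_measurableU.

Definition the_elt (X : choiceType) (P : set X) : option X :=
  xget None [set Some x | x in [set x | P = [set x]]].

(* Image and preimage under a partial function, given as [h : X -> option Y]
   with domain {x | h x <> None}. *)
Definition pimage (X Y : Type) (h : X -> option Y) (A : set X) : set Y :=
  [set y | exists2 x, A x & h x = Some y].

Definition ppreimage (X Y : Type) (h : X -> option Y) (B : set Y) : set X :=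
  [set x | exists2 y, B y & h x = Some y].

Section ProbabilityTree.
Context {R : realType}.
Variables (T : set (seq nat)) (mu : seq nat -> probability (seq nat) R).

Local Notation Lb := (@lebesgue_measure R).

Definition borel01 : set (set R) :=
  [set B : set R | B `<=` `[0, 1] /\ measurable B].

(* A probability measure on P(succ_T(t)) is a probability measure on
   P(seq nat) carried by succ_T(t); [mu t] is unconstrained for other t. *)
Definition is_prob_tree : Prop :=
  [/\ is_tree T, countable T &
      forall t, (T `\` maxT T) t -> mu t (succT T t) = 1%E].

(* [rev_ends r] is (a_t, b_t) for t = rev r; the recursion equations in terms
   of t are proved below. *)
Fixpoint rev_ends (r : seq nat) : R * R :=
  if r is k :: r' then
    let t := rev r' in
    let I := rev_ends r' in
    let w j := fine (Lb `[I.1, I.2]) * fine (mu t [set rcons t j]) in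
    let a := iteri k (fun j c => c + w j) I.1 in
    (a, a + w k)
  else (0, 1).

Definition a_ (t : seq nat) : R := (rev_ends (rev t)).1.
Definition b_ (t : seq nat) : R := (rev_ends (rev t)).2.

Definition I_ (t : seq nat) : set R := `[a_ t, b_ t].

Lemma I_nil : I_ [::] = `[0, 1]%classic.
Proof. by []. Qed.

Lemma a_rcons0 t : a_ (rcons t 0) = a_ t.
Proof. by rewrite /a_ rev_rcons. Qed.

Lemma b_rcons t k : b_ (rcons t k) =
  a_ (rcons t k) + fine (Lb (I_ t)) * fine (mu t [set rcons t k]).
Proof. by rewrite /a_ /b_ /I_ rev_rcons /= revK. Qed.

Lemma a_rconsS t k : a_ (rcons t k.+1) = b_ (rcons t k).
Proof. by rewrite /a_ /b_ !rev_rcons. Qed.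

Definition Q_ : set R := a_ @` T `|` b_ @` T.

Definition fminus (x : bdry T) : R := limn (fun n => a_ (restr x n)).
Definition fplus (x : bdry T) : R := limn (fun n => b_ (restr x n)).

Definition Istar (x : bdry T) : set R := \bigcap_n I_ (restr x n).

Definition IstarU (A : set (bdry T)) : set R := \bigcup_(x in A) Istar x.

Definition lambda (A : set (bdry T)) : \bar R := Lb (IstarU A).

Definition Vstar : set (bdry T) := [set x | lambda [set x] = 0%E].

Definition f_ (x : bdry T) : option R :=
  if `[< Vstar x >] then the_elt (Istar x) else None.

Definition g_ (y : R) : option (bdry T) :=
  if `[< (`[0, 1] `\` Q_) y >] then the_elt [set x | Istar x y] else None.

Definition GstarU (A : set (bdry T)) : set R :=
  \bigcup_(x in A `\` Vstar) `]fminus x, fplus x[%classic.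

Definition Gstar : set R := GstarU setT.

Definition Nstar : set (bdry T) :=
  \bigcup_(t in [set t | T t /\ lambda (cone T t) = 0%E]) cone T t.

End ProbabilityTree.

(* Main.v *)
(* Off the countable set Q of endpoints, "y lies in I*_x" is the graph of a
   partial function y |-> x (the intervals of siblings are adjacent, so two
   branches reaching y make y an endpoint), and for x in V it is the graph of f.
   Hence f[A] = I*(A /\ V) and g^-1[A] = I*(A) \ Q, and the class of A with
   I*(A) \ Q Borel is a sigma-algebra containing the cones, since
   I*([t]_T) \ Q = I_t \ Q.  Conversely f^-1 of a ray ]c, oo[ is V intersected
   with the union of the cones [t]_T with c < a_t.  The complement of V is
   countable (its points own disjoint open intervals, whose union is G), so all
   sets in the theorem are related by f up to countable sets; the only exception
   is the preimage of Q under f, which is countable once N is removed. *)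
Require Import Defs.
From mathcomp Require Import all_boot all_order all_algebra.
From mathcomp Require Import finmap.
From mathcomp Require Import all_classical all_reals all_analysis.
From mathcomp Require Import lra.

Set Implicit Arguments.
Unset Strict Implicit.
Unset Printing Implicit Defensive.

Import Order.TTheory GRing.Theory Num.Theory.
Import numFieldNormedType.Exports.

Local Open Scope classical_set_scope.
Local Open Scope ring_scope.
Local Open Scope ereal_scope.

(** * Unique elements and countable sets *)

Lemma the_eltP (X : choiceType) (P : set X) (x : X) :
  the_elt P = Some x <-> P = [set x].
Proof.
rewrite /the_elt; split => [|->].
  by case: xgetP => // _ _ [z -> <-] [->].
apply: xget_subset1; first by exists x.
move=> _ _ [u eu <-] [v ev <-]; congr Some.
by have : [set v] u by [rewrite -ev eu]; exact.
Qed.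

Lemma countable_image (X Y : Type) (f : X -> Y) (A : set X) :
  countable A -> countable (f @` A).
Proof. by apply: sub_countable; exact: card_image_le. Qed.

Lemma countableS (X : Type) (A B : set X) :
  A `<=` B -> countable B -> countable A.
Proof. by move=> AB; apply: sub_countable; exact: subset_card_le. Qed.

Lemma countableU (X : Type) (A B : set X) :
  countable A -> countable B -> countable (A `|` B).
Proof.
move=> cA cB; rewrite -bigcup2E; apply: bigcup_countable => // i _.
by rewrite /bigcup2; case: ifP => // _; case: ifP.
Qed.

Lemma countable_inj_on (X Y : Type) (f : X -> Y) (A : set X) :
  countable (f @` A) -> (forall x x', A x -> A x' -> f x = f x' -> x = x') ->
  countable A.
Proof.
move=> /countable_injP [h hinj] finj; apply/countable_injP.
exists (h \o f) => x x' /set_mem Ax /set_mem Ax' /=.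
by move=> /(hinj _ _ (mem_set (imageP f Ax)) (mem_set (imageP f Ax'))) /finj; apply.
Qed.

Lemma bigcup_countable_nat (X I : Type) (D : set I) (F : I -> set X) :
  countable D -> exists H : nat -> set X, \bigcup_(i in D) F i = \bigcup_n H n /\
    forall n, H n = set0 \/ exists2 i, D i & H n = F i.
Proof.
move=> /countable_injP [h hinj].
exists (fun n => \bigcup_(i in D `&` [set i | h i = n]) F i); split.
  apply/seteqP; split => [x [i Di Fx]|x [n _ [i [Di _] Fx]]].
    by exists (h i) => //; exists i.
  by exists i.
move=> n; have [[i [Di <-]]|N] := pselect (exists i, D i /\ h i = n).
  right; exists i => //; rewrite (_ : D `&` _ = [set i]) ?bigcup_set1//.
  apply/seteqP; split => [j [Dj /= /hinj]|j ->]; last by split.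
  by move=> /(_ (mem_set Dj) (mem_set Di)).
left; rewrite (_ : D `&` _ = set0) ?bigcup_set0//.
by apply/seteqP; split => // j Dj; apply: N; exists j.
Qed.

(** * Borel sets of a topological space *)

Section Borel.
Context {X : topologicalType}.
Implicit Types A B : set X.

Lemma borel0 : borel (@set0 X).
Proof. exact: sigma_algebra0. Qed.

Lemma borelC A : borel A -> borel (~` A).
Proof. by move=> mA; rewrite -setTD; exact: sigma_algebraCD. Qed.

Lemma borel_open A : open A -> borel A.
Proof. exact: sub_sigma_algebra. Qed.

Lemma borel_bigcup (I : Type) (D : set I) (F : I -> set X) :
  countable D -> (forall i, D i -> borel (F i)) -> borel (\bigcup_(i in D) F i).
Proof.
move=> /(bigcup_countable_nat F)[H [-> HF]] mF; apply: sigma_algebra_bigcup => n.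
by have [->|[i Di ->]] := HF n; [exact: borel0|exact: mF].
Qed.

Lemma borelU A B : borel A -> borel B -> borel (A `|` B).
Proof.
move=> mA mB; rewrite -bigcup2E; apply: borel_bigcup => // i _.
by rewrite /bigcup2; case: ifP => // _; case: ifP => // _; exact: borel0.
Qed.

Lemma borelI A B : borel A -> borel B -> borel (A `&` B).
Proof.
move=> mA mB; rewrite -[A `&` B]setCK setCI; apply: borelC.
by apply: borelU; exact: borelC.
Qed.

Lemma borelD A B : borel A -> borel B -> borel (A `\` B).
Proof. by move=> mA mB; apply: borelI => //; exact: borelC. Qed.

Hypothesis borel1 : forall x : X, borel [set x].

Lemma borel_countable A : countable A -> borel A.
Proof.
by move=> cA; rewrite -(image_id A) -bigcup_imset1; exact: borel_bigcup.
Qed.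

(** [B] consists of the part of [A] outside [C] and of a subset of [C], which is countable and hence
    Borel when points are. *)
Lemma eq_off_countable_borel A B C : countable C ->
  (forall x, ~ C x -> A x <-> B x) -> borel A -> borel B.
Proof.
move=> cC AB mA; rewrite (_ : B = (A `\` C) `|` (B `&` C)).
  apply: borelU; first by apply: borelD => //; exact: borel_countable.
  by apply: borel_countable; apply: countableS cC.
apply/seteqP; split => [x Bx|x [[Ax Cx]|[]//]]; last exact/AB.
by have [Cx|Cx] := pselect (C x); [right|left; split=> //; exact/AB].
Qed.

End Borel.

(** * Lebesgue measure and countable sets *)

Section Lebesgue.
Context {R : realType}.
Local Notation Lb := (@lebesgue_measure R).
Implicit Types A B C : set R.

Lemma countable_measurableR C : countable C -> measurable C.
Proof. by apply: countable_measurable => t; exact: measurable_set1. Qed.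

Lemma measurable_countable_bigcup (I : Type) (D : set I) (F : I -> set R) :
  countable D -> (forall i, D i -> measurable (F i)) ->
  measurable (\bigcup_(i in D) F i).
Proof.
move=> /(bigcup_countable_nat F)[H [-> HF]] mF; apply: bigcupT_measurable => n.
by have [->|[i Di ->]] := HF n; [exact: measurable0|exact: mF].
Qed.

Lemma eq_off_countable_measurable A B C : countable C ->
  (forall x, ~ C x -> A x <-> B x) -> measurable A -> measurable B.
Proof.
move=> cC AB mA; rewrite (_ : B = (A `\` C) `|` (B `&` C)).
  apply: measurableU.
    by apply: measurableD => //; exact: countable_measurableR.
  by apply: countable_measurableR; apply: countableS cC.
apply/seteqP; split => [x Bx|x [[Ax Cx]|[]//]]; last exact/AB.
by have [Cx|Cx] := pselect (C x); [right|left; split=> //; exact/AB].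
Qed.

Lemma eq_off_countable_lebesgue A B C : countable C ->
  (forall x, ~ C x -> A x <-> B x) -> measurable A -> Lb A = Lb B.
Proof.
move=> cC AB mA.
have mB := eq_off_countable_measurable cC AB mA.
have mC := countable_measurableR cC.
have dropC D : measurable D -> Lb D = Lb (D `\` C).
  move=> mD; rewrite (measureDI Lb mD mC).
  rewrite [X in _ + X]countable_lebesgue_measure0 ?adde0//.
  by apply: countableS cC => x [].
rewrite (dropC _ mA) (dropC _ mB); congr Lb.
by apply/seteqP; split => x [? Cx]; split => //; exact/(AB _ Cx).
Qed.

(** Reindexing along an injective code into [nat] reduces this to sigma-additivity for sequences. *)
Lemma measure_countable_bigcup (I : choiceType) (D : set I) (F : I -> set R) :
  countable D -> (forall i, D i -> measurable (F i)) -> trivIset D F ->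
  Lb (\bigcup_(i in D) F i) = \esum_(i in D) Lb (F i).
Proof.
move=> cD mF tF.
have [->|/set0P[x0 Dx0]] := eqVneq D set0.
  by rewrite bigcup_set0 esum_set0 measure0.
have /countable_injP[h hinj] := cD.
(* [x0] is only the default value of the inverse outside the image of [D]. *)
pose e := 'pinv_(fun=> x0) D h.
have eB : set_bij (h @` D) D e by exact: injpinv_bij.
have [eD einj esurj] := eB.
rewrite (@reindex_esum _ _ _ _ _ e _ eB)
  -{1}(surj_image_eq (image_subP.2 eD) esurj).
rewrite bigcup_image measure_bigcup/=; last 2 first.
- by move=> n [x Dx <-]; apply: mF; apply: eD; exact: imageP.
- move=> m n hm hn /(tF _ _ (eD _ hm) (eD _ hn)).
  by move/(einj _ _ (mem_set hm) (mem_set hn)).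
by rewrite nneseries_esum ?set_mem_set.
Qed.
End Lebesgue.

(** * Endpoints of the intervals of siblings *)

Section Endpoints.
Context {R : realType} (mu : seq nat -> probability (seq nat) R).
Implicit Types (t : seq nat) (k n : nat) (y : R).

Local Notation a := (a_ mu).
Local Notation b := (b_ mu).
Local Notation p t k := (fine (mu t [set rcons t k])).

Lemma endpoints_le t : (a t <= b t)%R.
Proof.
elim/last_ind: t => [|t k _]; first by rewrite /a_ /b_ /= ler01.
by rewrite b_rcons lerDl mulr_ge0 ?fine_ge0.
Qed.

Lemma length_I t : fine (lebesgue_measure (I_ mu t)) = (b t - a t)%R.
Proof.
rewrite /I_ lebesgue_measure_itv/= lte_fin.
have := endpoints_le t; rewrite le_eqVlt => /orP[/eqP->|->//].
by rewrite ltxx subrr.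
Qed.

(** Solves the recursion over siblings, so that containment in the parent and covering by the
    children reduce to partial sums of the weights. *)
Lemma a_rconsE t k :
  a (rcons t k) = (a t + (b t - a t) * \sum_(j < k) p t j)%R.
Proof.
elim: k => [|k IH]; first by rewrite a_rcons0 big_ord0 mulr0 addr0.
by rewrite a_rconsS b_rcons IH length_I big_ord_recr/= mulrDr addrA.
Qed.

Lemma b_rconsE t k :
  b (rcons t k) = (a t + (b t - a t) * \sum_(j < k.+1) p t j)%R.
Proof. by rewrite -a_rconsS a_rconsE. Qed.

Lemma sum_weights t n :
  (\sum_(j < n) p t j)%:E = \sum_(j < n) mu t [set rcons t j].
Proof.
rewrite -sumEFin; apply: eq_bigr => j _.
by rewrite fineK//; exact: fin_num_measure.
Qed.

Lemma trivIset_rcons t (D : set nat) : trivIset D (fun j => [set rcons t j]).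
Proof.
by move=> i j _ _ [_ [-> /= /eqP]]; rewrite eqseq_rcons => /andP[_ /eqP].
Qed.

Lemma sum_weights_le1 t n : (\sum_(j < n) p t j <= 1)%R.
Proof.
rewrite -lee_fin sum_weights.
rewrite -(measure_bigsetU (mu t) (F := fun j => [set rcons t j]))//.
  exact: probability_le1.
exact: trivIset_rcons.
Qed.

Lemma a_le_rcons t k : (a t <= a (rcons t k))%R.
Proof.
rewrite a_rconsE lerDl mulr_ge0 ?subr_ge0 ?endpoints_le//.
by apply: sumr_ge0 => j _; exact: fine_ge0.
Qed.

Lemma b_rcons_le t k : (b (rcons t k) <= b t)%R.
Proof.
rewrite b_rconsE -lerBrDl ler_piMr ?subr_ge0 ?endpoints_le//.
exact: sum_weights_le1.
Qed.

Lemma I_sub01 t : I_ mu t `<=` `[0%R, 1%R].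
Proof.
elim/last_ind: t => [|t k IH]; first by rewrite I_nil.
apply: subset_trans IH; apply: subset_itv; rewrite bnd_simp.
  exact: a_le_rcons.
exact: b_rcons_le.
Qed.

Lemma rcons_endpoints_lt t k l :
  (k < l)%N -> (b (rcons t k) <= a (rcons t l))%R.
Proof.
elim: l => // l IH; rewrite ltnS leq_eqVlt => /orP[/eqP->|/IH kl].
  by rewrite a_rconsS.
by rewrite a_rconsS (le_trans kl)// endpoints_le.
Qed.

Section Cover.
Context (T : set (seq nat)).
Hypothesis mu_succ : forall t, (T `\` maxT T) t -> mu t (succT T t) = 1.

Lemma succT_rcons t s : succT T t s -> exists k, s = rcons t k.
Proof.
move=> [_ /prefixP[u ->]]; rewrite size_cat -addn1 => /addnI.
by case: u => [|k []]// _; exists k; rewrite cats1.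
Qed.

(** [mu t] gives full measure to [succT T t], so every string outside [T] lies in a null set. *)
Lemma weight_succT t k : (T `\` maxT T) t ->
  mu t [set rcons t k] != 0 -> T (rcons t k).
Proof.
move=> /mu_succ m1 w0; apply: contrapT => nT; move/eqP: w0; apply.
have := @probability_setC _ _ _ (mu t) (succT T t) I.
rewrite m1 subee// => c0; apply/eqP; rewrite eq_le measure_ge0 andbT -c0.
by apply: le_measure; rewrite ?inE// => _ -> [] /nT.
Qed.

(* When succ_T(t) is infinite the intervals of the children leave out [b t],
   hence the strict inequality. *)
Lemma children_cover t y : (T `\` maxT T) t -> (a t <= y < b t)%R ->
  exists k, T (rcons t k) /\ I_ mu (rcons t k) y.
Proof.
move=> Tt /andP[ay yb].
have cvg1 : (\sum_(j < n) p t j)%R @[n --> \oo] --> (1%R : R).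
  have : \sum_(0 <= j < n) mu t [set rcons t j] @[n --> \oo]
      --> mu t (\bigcup_j [set rcons t j]).
    by apply: measure_semi_sigma_additive => //; exact: trivIset_rcons.
  have -> : mu t (\bigcup_j [set rcons t j]) = 1.
    apply/eqP; rewrite eq_le probability_le1//= -(mu_succ Tt).
    apply: le_measure; rewrite ?inE// => s /succT_rcons[k ->].
    by exists k.
  under eq_fun do rewrite big_mkord -sum_weights.
  by move/fine_cvgP => [_].
have cvgb : (a t + (b t - a t) * \sum_(j < n) p t j)%R @[n --> \oo] --> b t.
  have {2}-> : b t = (a t + (b t - a t) * 1)%R by rewrite mulr1 addrC subrK.
  by apply: cvgD; [exact: cvg_cst|exact: cvgMl_tmp].
have [n yn] : exists n, (y < a t + (b t - a t) * \sum_(j < n) p t j)%R.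
  by have [N _ /(_ N (leqnn N))] := cvgr_gt _ cvgb _ yb; exists N.
(* Take the first partial sum that carries the endpoint beyond [y]. It is not the empty sum, which
   gives [a t], so its index is some [k.+1], and [k] is the wanted child. *)
have [[|k] ky kmin] := ex_minnP
  (ex_intro (fun n => is_true (y < a t + (b t - a t) * \sum_(j < n) p t j)%R)
    n yn).
  by move: ky; rewrite big_ord0 mulr0 addr0 ltNge ay.
have {kmin} : (a t + (b t - a t) * \sum_(j < k) p t j <= y)%R.
  by rewrite leNgt; apply/negP => /kmin; rewrite ltnn.
rewrite -b_rconsE in ky *; rewrite -a_rconsE => yk; exists k.
split; last by rewrite /I_ /= in_itv/= yk ltW.
(* A child of weight zero has a degenerate interval, against [yk] and [ky]. *)
apply: weight_succT => //; apply/eqP => w0.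
by move: (le_lt_trans yk ky); rewrite b_rcons w0 mulr0 addr0 ltxx.
Qed.

End Cover.
End Endpoints.

(** * Branches and the topology of the boundary *)

Section Boundary.
Context (T : set (seq nat)).
Hypothesis treeT : is_tree T.
Implicit Types (x y : bdry T) (t : seq nat) (n m k : nat).

Lemma restr0 (x : xseq) : restr x 0 = [::].
Proof. by case: x => [s|u]; rewrite /= ?take0. Qed.

Lemma restr_size (x : xseq) n : restr x (size (restr x n)) = restr x n.
Proof.
case: x => [s|u] /=; last by rewrite size_mkseq.
have [sn|/ltnW sn] := leqP (size s) n; last by rewrite size_takel.
by rewrite !(take_oversize sn) take_size.
Qed.

Lemma restr_tree x n : T (restr x n).
Proof.
case: (bvalP x) => [[s [Ts _] <-]|[u Tu <-]] //=.
by case: treeT => _ /(_ _ _ Ts); apply; exact: prefix_take.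
Qed.

(** Lets inductions on the level treat finite and infinite points alike. *)
Lemma restr_step x n :
  (maxT T (restr x n) /\ restr x n.+1 = restr x n) \/
  (size (restr x n) = n /\ exists k, restr x n.+1 = rcons (restr x n) k).
Proof.
case: (bvalP x) => [[s Ms <-]|[u _ <-]] /=; last first.
  by right; rewrite size_mkseq; split=> //; exists (u n); rewrite mkseqS.
have [sn|sn] := leqP (size s) n.
  by left; rewrite !take_oversize// leqW.
right; rewrite size_takel 1?ltnW//; split=> //; exists (nth 0%N s n).
exact: take_nth.
Qed.

Lemma max_no_rcons t k : maxT T t -> ~ T (rcons t k).
Proof.
move=> [_ M] Tk; suff : succT T t (rcons t k) by rewrite M.
by split; rewrite ?size_rcons// prefix_rcons.
Qed.

Lemma restr_inj x y : (forall n, restr x n = restr y n) -> x = y.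
Proof.
suff E : (forall n, restr x n = restr y n) -> bval x = bval y.
  move/E; case: x y {E} => v vP [w wP] /= vw; case: _ / vw in wP *.
  by congr Bdry; exact: Prop_irrelevance.
case: (bvalP x) => [[s _ <-]|[u _ <-]];
  case: (bvalP y) => [[s' _ <-]|[u' _ <-]] /= E.
(* Two finite points are compared at a level beyond both lengths. One level beyond the length of a
   finite point, only an infinite point still has full length. *)
- have := E (size s + size s')%N.
  by rewrite !take_oversize ?leq_addr ?leq_addl// => ->.
- have := congr1 size (E (size s).+1).
  by rewrite size_mkseq take_oversize// => /esym /eqP; rewrite eqn_leq ltnn.
- have := congr1 size (E (size s').+1).
  by rewrite size_mkseq take_oversize// => /eqP; rewrite eqn_leq ltnn.
- congr inr; apply/funext => n; have := congr1 (nth 0%N ^~ n) (E n.+1).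
  by rewrite /= !nth_mkseq.
Qed.

(** Without a split the branches agree at every level by induction: where one of them rests the node
    is maximal, so the other cannot continue. *)
Lemma bdry_split x y : x <> y -> exists m i j,
  [/\ i <> j, restr x m.+1 = rcons (restr x m) i &
      restr y m.+1 = rcons (restr x m) j].
Proof.
move=> xy; apply: contrapT => nsplit; apply: xy; apply: restr_inj.
elim=> [|n IH]; first by rewrite !restr0.
have Tx := restr_tree x n.+1; have Ty := restr_tree y n.+1.
have [[Mx Ex]|[_ [i Ex]]] := restr_step x n;
  have [[My Ey]|[_ [j Ey]]] := restr_step y n.
- by rewrite Ex Ey.
- by move: Ty; rewrite Ey -IH => /max_no_rcons.
- by move: Tx; rewrite Ex IH => /max_no_rcons.
- rewrite Ex Ey -IH; congr rcons; apply: contrapT => ij; apply: nsplit.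
  by exists n, i, j; rewrite Ex Ey IH.
Qed.

Lemma open_cone t : T t -> open (cone T t).
Proof.
move=> Tt; exists [set cone T t]; last by rewrite bigcup_set1.
move=> _ ->; exists [fset t]%fset; last by rewrite set_fset1 bigcap_set1.
by move=> s /fset1P ->; exact/mem_set.
Qed.

(** The cones form a base: a finite intersection of cones around [x] contains the cone of [x] cut at
    the maximal length of their stems. *)
Lemma open_cones (A : set (bdry T)) : open A ->
  A = \bigcup_(t in T `&` [set t | cone T t `<=` A]) cone T t.
Proof.
move=> [D DI <-]; apply/seteqP; split => [x [C DC Cx]|x [t [_ tA] /tA]] //.
have [F FT FC] : exists2 F : {fset seq nat}, {subset F <= T} &
    \bigcap_(t in [set` F]) cone T t = C := DI _ DC.
exists (restr x (\max_(t <- F) size t)); last exact: restr_size.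
split; first exact: restr_tree.
move=> y yx; exists C => //; change (C y).
move: Cx; change (C x -> C y); rewrite -FC => xF t tF.
have le : (size t <= \max_(t <- F) size t)%N.
  by apply: (@leq_bigmax_seq _ _ _ size) => //.
have restr_le (z : xseq) n m : (n <= m)%N -> restr z n = take n (restr z m).
  case: z => [s|u] nm /=; first by rewrite take_takel.
  by rewrite /mkseq -map_take take_iota (minn_idPl nm).
have := xF t tF; rewrite /cone /= /extends => xt.
have tx : t = take (size t) (restr x (\max_(t <- F) size t)).
  by rewrite -restr_le.
(* For finite [x], [m] may fall short of the maximal length, but it still bounds the length of [t],
   a prefix of the cut. *)
move: yx; rewrite /cone /= /extends; set m := size (restr x _) => yx.
rewrite (@restr_le y _ m) ?yx//.
rewrite {1}tx size_take_min geq_minr//.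
Qed.

Lemma borel_cone t : T t -> borel (cone T t).
Proof. by move=> /open_cone; exact: borel_open. Qed.

Lemma bdry_borel1 x : borel [set x].
Proof.
suff -> : [set x] = ~` \bigcup_n ~` cone T (restr x n).
  apply: borelC; apply: borel_bigcup => // n _; apply: borelC.
  by apply: borel_cone; exact: restr_tree.
rewrite setC_bigcup; apply/seteqP; split => [_ -> n _|y yx].
  by rewrite setCK; exact: restr_size.
have {}yx n : cone T (restr x n) y by rewrite -[cone _ _]setCK; exact: yx.
apply: restr_inj; elim=> [|n IH]; first by rewrite !restr0.
(* Once [x] rests, its cones give nothing new, but [y] cannot continue beyond a maximal node. *)
have [[Mx Ex]|[sx [i Ex]]] := restr_step x n; last first.
  by have := yx n.+1; rewrite /cone /= /extends Ex size_rcons sx.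
have [[_ ->]|[_ [j Ey]]] := restr_step y n; first by rewrite Ex.
by have := restr_tree y n.+1; rewrite Ey IH => /max_no_rcons.
Qed.

End Boundary.

Section IntervalMaps.
Context {R : realType} (T : set (seq nat))
  (mu : seq nat -> probability (seq nat) R).
Hypothesis hT : is_prob_tree T mu.
Implicit Types (x : bdry T) (A : set (bdry T)) (y : R) (B : set R).

Local Notation Lb := (@lebesgue_measure R).
Local Notation a := (a_ mu).
Local Notation b := (b_ mu).
Local Notation V := (@Vstar R T mu).
Local Notation N := (@Nstar R T mu).
Local Notation G := (@Gstar R T mu).
Local Notation Q := (@Q_ R T mu).
Local Notation f := (@f_ R T mu).
Local Notation g := (@g_ R T mu).
Local Notation fm := (@fminus R T mu).
Local Notation fp := (@fplus R T mu).

Let treeT : is_tree T. Proof. by case: hT. Qed.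
Let countT : countable T. Proof. by case: hT. Qed.

(** * Limits of the endpoints along a branch *)

Lemma a_restr_homo x :
  {homo (fun n => a (restr x n)) : n m / (n <= m)%N >-> (n <= m)%R}.
Proof.
apply/nondecreasing_seqP => n.
have [[_ ->]|[_ [k ->]]] // := restr_step x n.
exact: a_le_rcons.
Qed.

Lemma b_restr_homo x :
  {homo (fun n => b (restr x n)) : n m / (n <= m)%N >-> (m <= n)%R}.
Proof.
apply/nonincreasing_seqP => n.
have [[_ ->]|[_ [k ->]]] // := restr_step x n.
exact: b_rcons_le.
Qed.

Lemma a_restr_le_b x n m : (a (restr x n) <= b (restr x m))%R.
Proof.
apply: (le_trans (a_restr_homo x (leq_addr m n))).
apply: (le_trans (endpoints_le _ _)).
exact: (b_restr_homo x (leq_addl n m)).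
Qed.

Lemma cvg_a_restr x : cvgn (fun n => a (restr x n)).
Proof.
apply: nondecreasing_is_cvgn; first exact: a_restr_homo.
by exists (b (restr x 0)) => _ [n _ <-]; exact: a_restr_le_b.
Qed.

Lemma cvg_b_restr x : cvgn (fun n => b (restr x n)).
Proof.
apply: nonincreasing_is_cvgn; first exact: b_restr_homo.
by exists (a (restr x 0)) => _ [n _ <-]; exact: a_restr_le_b.
Qed.

Lemma a_restr_le_fminus x n : (a (restr x n) <= fm x)%R.
Proof. exact: (nondecreasing_cvgn_le (a_restr_homo x) (@cvg_a_restr x)). Qed.

Lemma fplus_le_b_restr x n : (fp x <= b (restr x n))%R.
Proof. exact: (nonincreasing_cvgn_ge (b_restr_homo x) (@cvg_b_restr x)). Qed.

Lemma fminus_le_fplus x : (fm x <= fp x)%R.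
Proof.
apply: limr_ge; first exact: cvg_b_restr.
apply: nearW => m; apply: limr_le; first exact: cvg_a_restr.
by apply: nearW => n; exact: a_restr_le_b.
Qed.

Lemma IstarE x : Istar mu x = `[fm x, fp x]%classic.
Proof.
apply/seteqP; split => y /=; rewrite in_itv/=.
  move=> yI; apply/andP; split.
    apply: limr_le; first exact: cvg_a_restr.
    by apply: nearW => n; have := yI n Logic.I; rewrite /I_ /= in_itv => /andP[].
  apply: limr_ge; first exact: cvg_b_restr.
  by apply: nearW => n; have := yI n Logic.I; rewrite /I_ /= in_itv => /andP[].
move=> /andP[ly uy] n _; rewrite /I_ /= in_itv/=.
by rewrite (le_trans (a_restr_le_fminus x n) ly)
  (le_trans uy (fplus_le_b_restr x n)).
Qed.

Lemma Istar_itv x y : Istar mu x y <-> (fm x <= y <= fp x)%R.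
Proof. by rewrite IstarE /= in_itv. Qed.

Lemma Istar_I x y n : Istar mu x y -> (a (restr x n) <= y <= b (restr x n))%R.
Proof. by move=> /(_ n Logic.I); rewrite /I_ /= in_itv. Qed.

Lemma Istar_sub01 x : Istar mu x `<=` `[0%R, 1%R].
Proof. by move=> y /(_ 0%N Logic.I); rewrite restr0. Qed.

Lemma VstarE x : V x <-> fm x = fp x.
Proof.
rewrite /Vstar /lambda /IstarU /= bigcup_set1 IstarE lebesgue_measure_itv/= lte_fin.
have := fminus_le_fplus x; rewrite le_eqVlt => /orP[/eqP->|fmp].
  by rewrite ltxx.
rewrite fmp; split=> [|E]; last by rewrite E ltxx in fmp.
by rewrite -EFinB => -[] /eqP; rewrite subr_eq0 => /eqP.
Qed.

Lemma notVstar_lt x : ~ V x -> (fm x < fp x)%R.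
Proof.
move=> nV; rewrite lt_neqAle fminus_le_fplus andbT.
by apply/eqP => /VstarE.
Qed.

Lemma Istar_Vstar x y : V x -> Istar mu x y <-> y = fm x.
Proof.
move=> /VstarE E; rewrite Istar_itv -E -eq_le eq_sym.
by split=> [/eqP|->].
Qed.

(** On [V] the set [Istar mu x] is the singleton of [fm x], so [the_elt] succeeds and [f] is the
    restriction of [fm] to [V]. *)
Lemma f_P x y : f_ mu x = Some y <-> V x /\ Istar mu x y.
Proof.
rewrite /f_; case: asboolP => [Vx|nV]; last by split => // -[].
have IE : Istar mu x = [set fm x].
  by apply/seteqP; split => z; rewrite (Istar_Vstar _ Vx).
rewrite the_eltP (Istar_Vstar _ Vx); split=> [|[_ ->]//].
by rewrite IE => E; split=> //; have : [set fm x] (fm x) by []; rewrite {1}E.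
Qed.

Lemma pimage_fE A : pimage f A = IstarU mu (A `&` V).
Proof.
apply/seteqP; split => y.
  by move=> [x Ax /f_P[Vx Ixy]]; exists x.
by move=> [x [Ax Vx] Ixy]; exists x => //; exact/f_P.
Qed.

Lemma ppreimage_fE B : ppreimage f B = V `&` fm @^-1` B.
Proof.
apply/seteqP; split => x.
  by move=> [y By /f_P[Vx /(Istar_Vstar _ Vx) yE]]; split=> //; rewrite /= -yE.
by move=> [Vx Bx]; exists (fm x) => //; apply/f_P; split=> //; exact/Istar_Vstar.
Qed.

(** * Separation of branches and the countable exceptional sets *)

Lemma bdry_separated x x' : x <> x' -> exists n,
  (b (restr x n) <= a (restr x' n) \/ b (restr x' n) <= a (restr x n))%R.
Proof.
move=> /(bdry_split treeT)[m [i [j [/eqP ij Ei Ej]]]]; exists m.+1; rewrite Ei Ej.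
by move: ij; rewrite neq_ltn => /orP[ij|ij]; [left|right]; exact: rcons_endpoints_lt.
Qed.

(** Where the branches part, their intervals meet at most in an endpoint, which is never strictly
    between [fm x] and [fp x]. *)
Lemma Istar_open_disjoint x x' y :
  x <> x' -> (fm x < y < fp x)%R -> ~ Istar mu x' y.
Proof.
move=> /bdry_separated[n sep] /andP[ly uy] /(Istar_I n)/andP[ay yb].
have := a_restr_le_fminus x n; have := fplus_le_b_restr x n.
by case: sep; lra.
Qed.

(** A rational chosen in each of the disjoint open intervals tells the points outside [V] apart. *)
Lemma countable_notV : countable (~` V).
Proof.
pose q x : rat := xget 0%R [set r | (fm x < ratr r < fp x)%R].
have qP x : (~` V) x -> (fm x < ratr (q x) < fp x)%R.
  move=> /notVstar_lt /rat_in_itvoo[r]; rewrite in_itv/= => rP.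
  by apply: (@xgetPex _ 0%R [set r | (fm x < ratr r < fp x)%R]); exists r.
apply: (@countable_inj_on _ _ q) => // x x' /qP xq /qP x'q E.
apply: contrapT => /Istar_open_disjoint /(_ xq); apply.
by rewrite Istar_itv E; case/andP: x'q => /ltW -> /ltW ->.
Qed.

(** The countable set off which the closed and the open interval of a point outside [V] have the
    same members. *)
Definition jump_ends : set R := fm @` (~` V) `|` fp @` (~` V).

Lemma countable_jump_ends : countable jump_ends.
Proof. by apply: countableU; apply: countable_image; exact: countable_notV. Qed.

Lemma countable_Q : countable Q.
Proof. by apply: countableU; apply: countable_image. Qed.

Lemma endpoint_separated x x' y : x <> x' -> Istar mu x y -> Istar mu x' y -> Q y.
Proof.
move=> /bdry_separated[n sep] /(Istar_I n)/andP[ay yb] /(Istar_I n)/andP[ay' yb'].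
case: sep => sep.
  have -> : y = b (restr x n) by lra.
  by right; exists (restr x n) => //; exact: restr_tree.
have -> : y = a (restr x n) by lra.
by left; exists (restr x n) => //; exact: restr_tree.
Qed.

(** * The unique branch through a point off [Q], and the graph of [g] *)

Lemma Istar_inj x x' y : ~ Q y -> Istar mu x y -> Istar mu x' y -> x = x'.
Proof.
move=> nQ Ix Ix'; apply: contrapT => xx'; apply: nQ.
exact: (endpoint_separated xx').
Qed.

(** Either a maximal node has [y] in its interval and is itself the branch, or the descent from the
    root to children around [y] never ends; as [y] is no endpoint, [children_cover] applies at each
    node. *)
Lemma Istar_cover y : `[0%R, 1%R]%classic y -> ~ Q y -> exists x, Istar mu x y.
Proof.
move=> y01 nQ.
have T0 : T [::].
  by case: treeT => -[t Tt] /(_ _ _ Tt); apply; exact: prefix0s.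
have [[s [Ms Is]]|noM] := pselect (exists s, maxT T s /\ I_ mu s y).
  have sP : (inl @` maxT T `|` inr @` limT T) (inl s) by left; exists s.
  exists (Bdry sP) => n _.
  (* Level [n] is compared with level [maxn n (size s)], where the branch is [s] itself. *)
  apply/(subset_itv _ _)/Is; rewrite bnd_simp.
    have := a_restr_homo (Bdry sP) (leq_maxl n (size s)).
    by rewrite /= [X in (_ <= a X)%R]take_oversize ?leq_maxr.
  have := b_restr_homo (Bdry sP) (leq_maxl n (size s)).
  by rewrite /= [X in (b X <= _)%R]take_oversize ?leq_maxr.
(* The implication makes the choice of a child total; [0] is a dummy where the premise fails. *)
have step t : exists k, T t /\ I_ mu t y -> T (rcons t k) /\ I_ mu (rcons t k) y.
  have [[Tt It]|] := pselect (T t /\ I_ mu t y); last by exists 0%N.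
  have nM : (T `\` maxT T) t by split=> // Mt; apply: noM; exists t.
  have yab : (a t <= y < b t)%R.
    move: It; rewrite /I_ /= in_itv/= => /andP[-> yb] /=.
    rewrite lt_neqAle yb andbT; apply/eqP => E; apply: nQ.
    by right; exists t.
  case: hT => _ _ mu_succ.
  by have [k kP] := children_cover mu_succ nM yab; exists k.
have {step} [nxt nxtP] := choice step.
pose t_ n := iter n (fun t => rcons t (nxt t)) [::].
have tP n : T (t_ n) /\ I_ mu (t_ n) y by elim: n => //= n; exact: nxtP.
have tE n : mkseq (nxt \o t_) n = t_ n.
  by elim: n => // n IH; rewrite mkseqS IH.
have uP : (inl @` maxT T `|` inr @` limT T) (inr (nxt \o t_)).
  by right; exists (nxt \o t_) => // n; rewrite tE; case: (tP n).
by exists (Bdry uP) => n _ /=; rewrite tE; case: (tP n).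
Qed.

Lemma g_P y x :
  g_ T mu y = Some x <-> [/\ `[0%R, 1%R]%classic y, ~ Q y & Istar mu x y].
Proof.
rewrite /g_; case: asboolP => [[y01 nQ]|ny]; last first.
  by split => // -[y01 nQ _]; case: ny.
rewrite the_eltP; split=> [E|[_ _ Ixy]].
  by split=> //; have : [set x] x by []; rewrite -E.
apply/seteqP; split => [x' /= Ix'y|_ -> //].
exact: (Istar_inj nQ Ix'y Ixy).
Qed.

Lemma ppreimage_gE A : ppreimage g A = IstarU mu A `\` Q.
Proof.
apply/seteqP; split => y.
  by move=> [x Ax /g_P[_ nQ Ixy]]; split=> //; exists x.
move=> [[x Ax Ixy] nQ]; exists x => //; apply/g_P; split=> //.
exact: Istar_sub01 Ixy.
Qed.

(** By induction on [t]: the branch cannot rest at [t], which has a child in [T], and if it took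
    another child than [k], then [y] would be a common endpoint of siblings. *)
Lemma extends_Istar x t y :
  T t -> ~ Q y -> I_ mu t y -> Istar mu x y -> extends x t.
Proof.
move=> + nQ + Ixy; elim/last_ind: t => [|t k IH] Tk.
  by rewrite /extends restr0.
have Tt : T t by case: treeT => _ /(_ _ _ Tk); apply; exact: prefix_rcons.
rewrite /I_ /= in_itv/= => /andP[ay yb].
have {IH} Et : extends x t.
  apply: IH => //; rewrite /I_ /= in_itv/= (le_trans (a_le_rcons _ _ _) ay).
  by rewrite (le_trans yb (b_rcons_le _ _ _)).
rewrite /extends size_rcons.
have := restr_tree treeT x (size t).+1; have := Istar_I (size t).+1 Ixy.
have [[Mx _]|[_ [j ->]]] := restr_step x (size t).
  by rewrite Et in Mx; case: (max_no_rcons Mx Tk).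
rewrite Et => /andP[ay' yb'] Tj; congr rcons.
apply: contrapT => /eqP; rewrite neq_ltn.
move=> /orP[] /(rcons_endpoints_lt mu t) sep; apply: nQ.
  by right; exists (rcons t j) => //; lra.
by right; exists (rcons t k) => //; lra.
Qed.

(** * Borel sets of branches cover Borel sets of reals *)

Lemma measurable_IstarU_off_Q A : borel A -> measurable (IstarU mu A `\` Q).
Proof.
have mQ := countable_measurableR countable_Q.
pose S := [set A : set (bdry T) | measurable (IstarU mu A `\` Q)].
move: A; apply: (@smallest_sub _ _ _ S).
  split=> [|A mA|F mF]; rewrite /S /=.
  - by rewrite /IstarU bigcup_set0 set0D.
  (* Complements pass through because off [Q] each point of the unit interval lies on exactly one
     branch. *)
  - rewrite (_ : _ `\` Q = (`[0%R, 1%R] `\` Q) `\` (IstarU mu A `\` Q)).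
      by apply: measurableD => //; exact: measurableD.
    apply/seteqP; split => y.
      move=> [[x [_ nA] Ixy] nQ]; split.
        by split=> //; exact: Istar_sub01 Ixy.
      by move=> [[x' Ax' Ix'y] _]; apply: nA; rewrite (Istar_inj nQ Ixy Ix'y).
    move=> [[y01 nQ] nA]; split=> //; have [x Ixy] := Istar_cover y01 nQ.
    by exists x => //; split=> // Ax; apply: nA; split=> //; exists x.
  - rewrite /IstarU bigcup_bigcup setD_bigcupl.
    by apply: bigcup_measurable => k _; exact: mF.
(* An open set is a countable union of cones, and off [Q] the cone of [t] fills [I_ mu t], since the
   branch through a point of that interval extends [t]. *)
move=> A /(open_cones treeT) AE; rewrite /S /= AE /IstarU.
rewrite bigcup_bigcup setD_bigcupl.
rewrite (_ : \bigcup_(i in _) _ =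
  \bigcup_(i in T `&` [set t | cone T t `<=` A]) (I_ mu i `\` Q)); last first.
  apply: eq_bigcupr => t [Tt _]; apply/seteqP; split => y [].
    move=> [x xt Ixy] nQ; split=> //.
    by rewrite -(xt : restr x (size t) = t); exact: Ixy.
  move=> It nQ; split=> //.
  have y01 := I_sub01 It.
  have [x Ixy] := Istar_cover y01 nQ; exists x => //.
  exact: (extends_Istar Tt nQ It Ixy).
apply: measurable_countable_bigcup => [|t _]; last by rewrite /I_; exact: measurableD.
by apply: countableS countT => t [].
Qed.


Lemma measurable_IstarU A : borel A -> measurable (IstarU mu A).
Proof.
move=> /measurable_IstarU_off_Q.
apply: (eq_off_countable_measurable countable_Q) => y nQ.
by split=> [[]|].
Qed.

Lemma borel_Vstar : borel V.
Proof.
rewrite -[V]setCK; apply: borelC; apply: borel_countable countable_notV.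
exact: bdry_borel1.
Qed.

(** * Jump intervals and the splitting of [lambda] *)

Lemma measurable_GstarU A : measurable (GstarU mu A).
Proof.
apply: measurable_countable_bigcup => //.
by apply: countableS countable_notV => x [].
Qed.

Lemma trivIset_jumps A :
  trivIset (A `\` V) (fun x => `]fm x, fp x[%classic : set R).
Proof.
move=> x x' _ _ [y []] /=; rewrite !in_itv/= => xy /andP[ly uy].
apply: contrapT => /Istar_open_disjoint /(_ xy); apply.
by rewrite Istar_itv !ltW.
Qed.

(** The countably many jumps are disjoint, and each has the length of its closed interval. *)
Lemma lebesgue_GstarU A : Lb (GstarU mu A) = \esum_(x in A `\` V) Lb (Istar mu x).
Proof.
rewrite measure_countable_bigcup//.
- by apply: eq_esum => x _; rewrite IstarE !lebesgue_measure_itv.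
- by apply: countableS countable_notV => x [].
- exact: trivIset_jumps.
Qed.

Lemma GstarU_sub A : GstarU mu A `<=` G.
Proof. by move=> y [x [Ax nV] xy]; exists x. Qed.

Lemma Istar_notG x y : V x -> Istar mu x y -> ~ G y.
Proof.
move=> Vx Ixy [x' [_ nV]] /=; rewrite in_itv/= => x'y.
by apply: (Istar_open_disjoint _ x'y Ixy) => E; apply: nV; rewrite E.
Qed.

Lemma Istar_jump x y :
  ~ jump_ends y -> ~ V x -> Istar mu x y -> (fm x < y < fp x)%R.
Proof.
move=> nE nV /Istar_itv/andP[ly uy]; rewrite !lt_neqAle ly uy !andbT.
by apply/andP; split; apply/eqP => E; apply: nE; [left|right]; exists x.
Qed.

Lemma IstarU_Vstar A y : ~ jump_ends y ->
  IstarU mu (A `&` V) y <-> IstarU mu A y /\ ~ G y.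
Proof.
move=> nE; split=> [[x [Ax Vx] Ixy]|[[x Ax Ixy] nG]].
  by split; [exists x|exact: Istar_notG Ixy].
exists x => //; split=> //; apply: contrapT => nV; apply: nG; exists x => //.
by rewrite /= in_itv /= Istar_jump.
Qed.

Lemma IstarU_split A y : ~ jump_ends y ->
  (IstarU mu (A `&` V) `|` GstarU mu A) y <-> IstarU mu A y.
Proof.
move=> nE; split=> [[[x [Ax _] Ixy]|[x [Ax _]]]|[x Ax Ixy]].
- by exists x.
- by rewrite /= in_itv/= => /andP[ly uy]; exists x => //; rewrite Istar_itv !ltW.
- have [Vx|nV] := pselect (V x); first by left; exists x.
  by right; exists x => //=; rewrite in_itv/= Istar_jump.
Qed.

(** The jumps miss every [Istar mu x] with [x] in [V], so the two pieces are disjoint, and up to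
    [jump_ends] they make up [IstarU mu A]. *)
Lemma lambda_split A : borel A ->
  lambda mu A = lambda mu (A `&` V) + Lb (GstarU mu A).
Proof.
move=> mA; have mAV := measurable_IstarU (borelI mA borel_Vstar).
have mG := measurable_GstarU A.
rewrite /lambda -measureU//; last first.
  apply/seteqP; split=> // y [[x [_ Vx] Ixy]] /GstarU_sub.
  exact: Istar_notG Ixy.
apply/esym/(eq_off_countable_lebesgue countable_jump_ends) => [y|].
  exact: IstarU_split.
exact: measurableU.
Qed.

(** * Preimages under [f] *)

Lemma IstarU_ppreimage B y : B `<=` `[0%R, 1%R] -> ~ (Q `|` jump_ends) y ->
  (B `\` G) y <-> IstarU mu (ppreimage f B) y.
Proof.
move=> B01 nQE; rewrite ppreimage_fE; split=> [[By nG]|].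
  have [x Ixy] := Istar_cover (B01 _ By) (fun q => nQE (or_introl q)).
  (* Since [y] is in no jump, its branch belongs to [V], and [f] sends it back to [y]. *)
  have Vx : V x.
    apply: contrapT => nV; apply: nG; exists x => //=.
    by rewrite in_itv /= Istar_jump// => e; apply: nQE; right.
  by exists x => //; split=> //=; rewrite -((Istar_Vstar _ Vx).1 Ixy).
move=> [x [Vx Bx] Ixy]; split; last exact: Istar_notG Ixy.
by rewrite ((Istar_Vstar _ Vx).1 Ixy).
Qed.

Lemma countable_exc : countable (Q `|` jump_ends).
Proof. by apply: countableU; [exact: countable_Q|exact: countable_jump_ends]. Qed.

Lemma borel_ppreimage_f B : measurable B -> borel (ppreimage f B).
Proof.
rewrite ppreimage_fE; pose S := [set B : set R | borel (V `&` fm @^-1` B)].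
change ((@ocitv R).-sigma.-measurable B -> S B).
rewrite measurable_realfun.RGenOInfty.measurableE.
apply: smallest_sub.
  split=> [|C mC|F mF]; rewrite /S /=.
  - by rewrite preimage_set0 setI0; exact: borel0.
  - rewrite (_ : _ `&` _ = V `\` (V `&` fm @^-1` C)).
      by apply: borelD => //; exact: borel_Vstar.
    apply/seteqP; split => x [Vx]; first by move=> [_ nC]; split=> // -[].
    by move=> nC; split=> //; split=> // Cx; apply: nC.
  - rewrite preimage_bigcup setI_bigcupr.
    by apply: borel_bigcup => // n _; exact: mF.
move=> _ [c ->]; rewrite /S /=.
(* [fm x] is the limit of increasing left endpoints, so it exceeds [c] exactly when one of them
   does. *)
rewrite (_ : _ @^-1` _ =
    \bigcup_(t in T `&` [set t | (c < a t)%R]) cone T t); last first.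
  apply/seteqP; split => x /=; rewrite in_itv/= andbT.
    move=> cx; have [n cn] : exists n, (c < a (restr x n))%R.
      by have [n _ /(_ n (leqnn n))] := cvgr_gt _ (@cvg_a_restr x) _ cx; exists n.
    by exists (restr x n); [split=> //; exact: restr_tree|exact: restr_size].
  move=> [t [Tt /= ct] xt]; apply: (lt_le_trans ct).
  by rewrite -(xt : restr x (size t) = t) a_restr_le_fminus.
apply: borelI; first exact: borel_Vstar.
apply: borel_bigcup => [|t [Tt _]]; last exact: borel_cone.
by apply: countableS countT => t [].
Qed.

(** * Null cones and the preimage of [Q] under [f] *)

Lemma borel_Nstar : borel N.
Proof.
apply: borel_bigcup => [|t [Tt _]]; last exact: borel_cone.
by apply: countableS countT => t [].
Qed.

(** If the interval of a node is degenerate, all branches through the node share one point, so its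
    cone is null. *)
Lemma notNstar_lt x n : ~ N x -> (a (restr x n) < b (restr x n))%R.
Proof.
move=> nN; rewrite lt_neqAle endpoints_le andbT; apply/eqP => E; apply: nN.
exists (restr x n); last exact: restr_size.
split; first exact: restr_tree.
apply: countable_lebesgue_measure0.
apply: countableS (countable1 (a (restr x n))) => y [z zx Izy].
have := Istar_I (size (restr x n)) Izy.
by rewrite (zx : restr z (size _) = _) -E -eq_le eq_sym => /eqP.
Qed.

(* Off N the intervals along a branch are nondegenerate, so at most two branches
   reach a given endpoint: one strictly from each side. *)
Lemma countable_fminus_Q : countable (V `&` (fm @^-1` Q `\` N)).
Proof.
(* [L] has the values strictly above all left endpoints, [U] those strictly below all right
   endpoints; [fm] is injective on each. *)
pose L := V `&` fm @^-1` Q `&`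
  [set x : bdry T | forall n, (a (restr x n) < fm x)%R].
pose U := V `&` fm @^-1` Q `&`
  [set x : bdry T | forall n, (fm x < b (restr x n))%R].
apply: (@countableS _ _ (L `|` U)).
  move=> x [Vx [Qx nN]].
  (* Once a left endpoint reaches [fm x], nondegeneracy at level [maxn n m] puts the right endpoint
     of level [m] strictly above it. *)
  have [xn|] := pselect (exists n, (fm x <= a (restr x n))%R).
    right; split=> // m; have [n xn'] := xn.
    have := notNstar_lt (maxn n m) nN.
    have := a_restr_homo x (leq_maxl n m); have := b_restr_homo x (leq_maxr n m).
    by lra.
  move=> nxn; left; split=> // n; rewrite ltNge; apply/negP => xn.
  by apply: nxn; exists n.
have Ifm x : V x -> Istar mu x (fm x) by move=> Vx; exact/Istar_Vstar.
apply: countableU; apply: (@countable_inj_on _ _ fm).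
- by apply: countableS countable_Q => _ [x [[_ Qx] _] <-].
(* Were the interval of [x] to the left of that of [x'], the common value would be at most the right
   end of the former, hence at most the left end of the latter, against [Lx']. *)
- move=> x x' [[Vx _] Lx] [[Vx' _] Lx'] E; apply: contrapT => /bdry_separated[n].
  have := Istar_I n (Ifm _ Vx); have := Istar_I n (Ifm _ Vx').
  by have := Lx n; have := Lx' n; rewrite E => ? ? /andP[? ?] /andP[? ?] [] ?; lra.
- by apply: countableS countable_Q => _ [x [[_ Qx] _] <-].
- move=> x x' [[Vx _] Ux] [[Vx' _] Ux'] E; apply: contrapT => /bdry_separated[n].
  have := Istar_I n (Ifm _ Vx); have := Istar_I n (Ifm _ Vx').
  by have := Ux n; have := Ux' n; rewrite E => ? ? /andP[? ?] /andP[? ?] [] ?; lra.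
Qed.

(** * Borel criteria through [f] and [g] *)

Lemma pimage_f_sub01 A : pimage f A `<=` `[0%R, 1%R].
Proof. by rewrite pimage_fE => y [x _] /Istar_sub01. Qed.

Lemma borel01_pimage_f A : borel A -> borel01 (pimage f A).
Proof.
move=> mA; split; first exact: pimage_f_sub01.
rewrite pimage_fE; apply: measurable_IstarU.
by apply: borelI => //; exact: borel_Vstar.
Qed.

(** Outside [N], [A] agrees up to a countable set with the preimage of its image: off [Q] the value
    of [f] determines the point, and [countable_fminus_Q] bounds the rest. *)
Lemma borel_of_pimage_f A :
  borel (A `&` N) -> borel01 (pimage f A) -> borel A.
Proof.
move=> mAN [_ /borel_ppreimage_f mfA].
have mS : borel ((A `&` N) `|` (ppreimage f (pimage f A) `\` N)).
  by apply: borelU => //; apply: borelD => //; exact: borel_Nstar.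
apply: eq_off_countable_borel mS; first exact: bdry_borel1.
  exact: countableU countable_notV countable_fminus_Q.
move=> x /not_orP[/contrapT Vx nD]; rewrite ppreimage_fE pimage_fE.
have [Nx|nN] := pselect (N x).
  by split=> [[[]//|[_ /(_ Nx)]]//|Ax]; left.
have nQ : ~ Q (fm x) by move=> Qx; exact: nD.
have Ix : Istar mu x (fm x) by exact/Istar_Vstar.
split=> [[[_ /nN]//|[[_ [x' [Ax' _] Ix']] _]]|Ax].
  by rewrite (Istar_inj nQ Ix Ix').
by right; split=> //; split=> //; exists x.
Qed.

(** The part in [G] is given, and up to a countable set the rest is [IstarU] of the preimage. *)
Lemma measurable_of_ppreimage_f B : B `<=` `[0%R, 1%R] ->
  borel01 (B `&` G) -> borel (ppreimage f B) -> borel01 B.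
Proof.
move=> B01 [_ mBG] /measurable_IstarU mfB; split=> //.
have mS := measurableU _ _ mBG mfB.
apply: (eq_off_countable_measurable countable_exc) mS => y ny; split.
  by case=> [[]//|]; rewrite -IstarU_ppreimage// => -[].
move=> By; have [Gy|nG] := pselect (G y); first by left.
by right; rewrite -IstarU_ppreimage.
Qed.

Lemma lambda_ppreimage_f B : borel01 B ->
  lambda mu (ppreimage f B) = Lb (B `\` G).
Proof.
move=> [B01 mB]; apply/esym/(eq_off_countable_lebesgue countable_exc) => [y ny|].
  exact: IstarU_ppreimage.
by apply: measurableD => //; exact: measurable_GstarU.
Qed.

(** Between [V] and the complement of [Q], [f] and [g] are inverse to each other; this carries the
    results on [f] over to [g]. *)
Lemma pimage_gE B : B `<=` `[0%R, 1%R] ->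
  pimage g B `&` V = ppreimage f (B `\` Q).
Proof.
move=> B01; rewrite ppreimage_fE; apply/seteqP; split => x.
  move=> [[y By /g_P[_ nQ Ixy]] Vx]; split=> //=.
  by rewrite -((Istar_Vstar _ Vx).1 Ixy).
move=> [Vx [Bx nQ]]; split=> //; exists (fm x) => //; apply/g_P; split=> //.
  exact: B01.
exact/Istar_Vstar.
Qed.

Lemma borel_pimage_g B : B `<=` `[0%R, 1%R] ->
  borel (pimage g B) <-> borel (ppreimage f (B `\` Q)).
Proof.
move=> B01; rewrite -pimage_gE//; split=> [mg|].
  by apply: borelI => //; exact: borel_Vstar.
apply: eq_off_countable_borel countable_notV _; first exact: bdry_borel1.
by move=> x /contrapT Vx; split=> [[]|].
Qed.

Lemma borel01_pimage_g B : B `<=` `[0%R, 1%R] ->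
  borel01 B <-> borel01 (B `&` G) /\ borel (pimage g B).
Proof.
have mQ := countable_measurableR countable_Q.
move=> B01; rewrite borel_pimage_g//; split=> [[_ mB]|[mBG mfB]].
  split; last by apply: borel_ppreimage_f; exact: measurableD.
  by split=> [y [/B01]//|]; apply: measurableI => //; exact: measurable_GstarU.
apply: measurable_of_ppreimage_f => //.
(* The part of [B] in [Q] is invisible to [g]. It is countable, hence Borel, so its preimage is
   Borel even when uncountable. *)
rewrite (_ : ppreimage _ B = ppreimage f (B `\` Q) `|` ppreimage f (B `&` Q)).
  apply: borelU => //; apply: borel_ppreimage_f; apply: countable_measurableR.
  by apply: countableS countable_Q => y [].
by rewrite !ppreimage_fE -setIUr -preimage_setU setUC setUIDK.
Qed.


Lemma borel01_ppreimage_g A : borel A -> borel01 (ppreimage g A).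
Proof.
move=> mA; rewrite ppreimage_gE; split; last exact: measurable_IstarU_off_Q.
by move=> y [[x _ /Istar_sub01]].
Qed.

Lemma lambda_ppreimage_g A : borel A -> Lb (ppreimage g A) = lambda mu A.
Proof.
move=> mA; rewrite ppreimage_gE.
apply: (eq_off_countable_lebesgue countable_Q) => [y nQ|].
  by split=> [[]|].
exact: measurable_IstarU_off_Q.
Qed.

(** Up to a countable set, the image under [f] is the preimage under [g] with the jumps removed, so
    [borel_of_pimage_f] applies. *)
Lemma borel_of_ppreimage_g A :
  borel (A `&` N) -> borel01 (ppreimage g A) -> borel A.
Proof.
rewrite ppreimage_gE => mAN [_ mgA].
apply: borel_of_pimage_f => //; split; first exact: pimage_f_sub01.
rewrite pimage_fE.
have mS := measurableD mgA (measurable_GstarU setT).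
apply: (eq_off_countable_measurable countable_exc) mS => y /not_orP[nQ nE].
by rewrite (IstarU_Vstar _ nE); split=> [[[]]|[]].
Qed.

Lemma lambda_pimage_g B : borel01 B ->
  Lb (B `\` G) = lambda mu (pimage g B `&` V).
Proof.
move=> [B01 mB]; have mBG : measurable (B `\` G).
  by apply: measurableD => //; exact: measurable_GstarU.
rewrite pimage_gE// lambda_ppreimage_f.
  apply: (eq_off_countable_lebesgue countable_Q) mBG => y nQ.
  by split=> [[]|[[]]].
split=> [y [/B01]//|]; apply: measurableD => //.
exact: countable_measurableR countable_Q.
Qed.

End IntervalMaps.

(** * Images and preimages under [f] and [g], collected *)

Theorem theorem6p19 (R : realType) (T : set (seq nat))
    (mu : seq nat -> probability (seq nat) R)
    (hT : is_prob_tree T mu)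
    (hsucc : forall t, (T `\` maxT T) t ->
       exists alpha : option nat, below 0 alpha /\
         succT T t = [set rcons t k | k in [set k | below k alpha]])
    (A : set (bdry T)) (B : set R) (hB : B `<=` `[0%R, 1%R]) :
  let Lb := @lebesgue_measure R in
  let lam := lambda mu in
  let f := f_ mu in
  let g := g_ T mu in
  let V := Vstar mu in
  let N := Nstar mu in
  let G := Gstar T mu in
  (* (a) *)
  (borel A ->
     [/\ borel01 (pimage f A),
         Lb (pimage f A) = lam (A `&` V),
         lam A = Lb (pimage f A) + Lb (GstarU mu A) &
         lam A = Lb (pimage f A) + \esum_(x in A `\` V) Lb (Istar mu x)]) /\
  (* (b) *)
  (borel01 B ->
     [/\ borel (ppreimage f B),
         lam (ppreimage f B) = Lb (B `\` G) &
         Lb B = lam (ppreimage f B) + Lb (B `&` G)]) /\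
  (* (c) *)
  (borel A <-> borel (A `&` N) /\ borel01 (pimage f A)) /\
  (* (d) *)
  (borel01 B <-> borel01 (B `&` G) /\ borel (ppreimage f B)) /\
  (* (e) *)
  ((borel01 B <-> borel01 (B `&` G) /\ borel (pimage g B)) /\
   (borel01 B -> Lb (B `\` G) = lam (pimage g B `&` V))) /\
  (* (f) *)
  ((borel A <-> borel (A `&` N) /\ borel01 (ppreimage g A)) /\
   (borel A -> Lb (ppreimage g A) = lam A)).
Proof.
move=> Lb lam f g V N G.
have mG : measurable G := measurable_GstarU hT setT.
have fA : Lb (pimage f A) = lam (A `&` V) by rewrite /f pimage_fE.
split=> [mA|].
  split=> //; first exact: borel01_pimage_f.
    by rewrite fA; exact: lambda_split.
  by rewrite fA -lebesgue_GstarU//; exact: lambda_split.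
split=> [mB|].
  split; [exact: borel_ppreimage_f mB.2|exact: lambda_ppreimage_f|].
  by rewrite /lam lambda_ppreimage_f//; exact: (measureDI lebesgue_measure mB.2 mG).
have AN : borel A -> borel (A `&` N) by move=> mA; exact: borelI (borel_Nstar hT).
split; first split=> [mA|[]].
- by split; [exact: AN|exact: borel01_pimage_f].
- exact: borel_of_pimage_f.
split; first split=> [mB|[]].
- split; last exact: borel_ppreimage_f mB.2.
  by split=> [y [/hB]//|]; apply: measurableI mB.2 mG.
- exact: measurable_of_ppreimage_f.
split; first by split; [exact: borel01_pimage_g|exact: lambda_pimage_g].
split; last exact: lambda_ppreimage_g.
split=> [mA|[]]; last exact: borel_of_ppreimage_g.
by split; [exact: AN|exact: borel01_ppreimage_g].
Qed.
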